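(* Let $n\geq 1$ and let $A\in M_{n,n}(\mathbb{R}_{\geqslant})$ be a matrix with a right $\odot$-inverse, i.e. there exists $B\in M_{n,n}(\mathbb{R}_{\geqslant})$ such that $A\odot B=I$. Then there exist a permutation $\sigma\in\Sigma_n$ and a diagonal matrix $D=(D_1,\ldots,D_n)\in M_{n,n}(\mathbb{R}_{\geqslant})$ (with columns $D_1,\ldots,D_n$) whose diagonal entries are all nonzero, such that $$A=(D_{\sigma^{-1}(1)},\ldots,D_{\sigma^{-1}(n)}),$$ i.e. the $j$-th column of $A$ is $D_{\sigma^{-1}(j)}$. Moreover, the matrix $B$ is determined by $$B_{ij}=\begin{cases}0 & \text{if } A_{ji}=0,\\ \dfrac{1}{A_{ji}} & \text{if } A_{ji}\neq 0.\end{cases}$$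
   Context: $\mathbb{R}_{\geqslant}=[0,\infty)$ is the set of nonnegative real numbers. $M_{m,n}(\mathbb{R}_{\geqslant})$ is the set of $m\times n$ matrices with entries in $\mathbb{R}_{\geqslant}$, and $A_{ij}$ denotes the $(i,j)$ entry of $A$. For $A\in M_{m,p}(\mathbb{R}_{\geqslant})$ and $B\in M_{p,n}(\mathbb{R}_{\geqslant})$ the tropical product $A\odot B\in M_{m,n}(\mathbb{R}_{\geqslant})$ is defined by $$(A\odot B)_{ij}=\max\{A_{ik}B_{kj} : 1\leq k\leq p\},$$ where $A_{ik}B_{kj}$ is the usual product of real numbers. $I$ is the usual identity matrix. $\Sigma_n$ is the permutation group on $n$ letters. *)

(* Defs.v *)
From HB Require Import structures.
From mathcomp Require Import all_boot all_order all_algebra all_fingroup.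
From mathcomp Require Import reals.

Set Implicit Arguments.
Unset Strict Implicit.
Unset Printing Implicit Defensive.

Import Order.TTheory GRing.Theory Num.Theory.
Local Open Scope ring_scope.

(* The maximum is taken with default value 0. This is the plain maximum of the
   A i k * B k j when p > 0 and the entries are nonnegative; it is not meant to
   be used on matrices with negative entries. *)
Definition tropmul (R : realType) (m p n : nat)
    (A : 'M[R]_(m, p)) (B : 'M[R]_(p, n)) : 'M[R]_(m, n) :=
  \matrix_(i < m, j < n) \big[Num.max/0]_(k < p) (A i k * B k j).

Notation "A ⊙ B" := (tropmul A B) (at level 40, left associativity) : ring_scope.

(* Main.v *)
(* Each diagonal entry of the product supplies a witness f i with
   A i (f i) * B (f i) i = 1, while the off-diagonal zeros, the entries being
   nonnegative, force A i k * B k j = 0 for all k when i != j. Hence f is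
   injective, so a permutation, and A i k and B k i both vanish for k != f i. *)
Require Import Defs.
From HB Require Import structures.
From mathcomp Require Import all_boot all_order all_algebra all_fingroup.
From mathcomp Require Import reals.

Import Order.TTheory GRing.Theory Num.Theory.
Local Open Scope ring_scope.

Lemma le_tropmul {R : realType} {m p n : nat} (A : 'M[R]_(m, p))
    (B : 'M[R]_(p, n)) i k j : A i k * B k j <= (A ⊙ B) i j.
Proof. by rewrite mxE; exact: (le_bigmax _ (fun k => A i k * B k j)). Qed.

(** Positivity rules out the default value 0 of the maximum: if no term attained it, then all terms
    and the default would lie strictly below it, making it smaller than itself. *)
Lemma tropmul_attained {R : realType} {m p n : nat} {A : 'M[R]_(m, p)}
    {B : 'M[R]_(p, n)} i j :
  0 < (A ⊙ B) i j -> exists k, A i k * B k j = (A ⊙ B) i j.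
Proof.
move=> AB_gt0; have [/existsP[k /eqP]|] :=
  boolP [exists k, A i k * B k j == (A ⊙ B) i j]; first by exists k.
rewrite negb_exists => /forallP neqAB.
have : (A ⊙ B) i j < (A ⊙ B) i j.
  by rewrite {1}mxE; apply: bigmax_lt => // k _; rewrite lt_neqAle neqAB le_tropmul.
by rewrite ltxx.
Qed.

Section RightInverse.

Context {R : realType} {n : nat} {A B : 'M[R]_n}.
Hypotheses (hA : A \is a mxOver Num.nneg) (hB : B \is a mxOver Num.nneg).
Hypothesis hAB : A ⊙ B = 1%:M.

Lemma tropinv_offdiag k {i j} : i != j -> A i k * B k j = 0.
Proof.
move=> neq_ij; apply/eqP; rewrite eq_le mulr_ge0 ?andbT; last 2 first.
- exact: (mxOverP hA).
- exact: (mxOverP hB).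
by rewrite (le_trans (le_tropmul A B i k j)) // hAB mxE (negPf neq_ij).
Qed.

Lemma tropinv_perm : exists s : 'S_n,
  [/\ forall i, A i (s i) * B (s i) i = 1,
      forall i k, k != s i -> A i k = 0 &
      forall i k, k != s i -> B k i = 0].
Proof.
have /fin_all_exists[f fP] i : exists k, A i k * B k i = 1.
  have ABii : (A ⊙ B) i i = 1 by rewrite hAB mxE eqxx.
  by have [|k] := @tropmul_attained _ _ _ _ A B i i; rewrite ABii ?ltr01 //; exists k.
have Afi i : A i (f i) != 0.
  by apply/eqP => A0; have /eqP := fP i; rewrite A0 mul0r eq_sym oner_eq0.
have Bfi i : B (f i) i != 0.
  by apply/eqP => B0; have /eqP := fP i; rewrite B0 mulr0 eq_sym oner_eq0.
have f_inj : injective f.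
  (* If [f i = f j] with [i != j], the off-diagonal term [A i (f i) * B (f i) j] is zero although
     both factors are nonzero. *)
  move=> i j eq_f; apply/eqP; apply: contraT => /(tropinv_offdiag (f i))/eqP.
  by rewrite mulf_eq0 (negPf (Afi i)) eq_f (negPf (Bfi j)).
exists (perm f_inj); split=> i => [|k|k]; first by rewrite permE fP.
(* Surjectivity gives [k = f j] with [j != i]; the nonzero [B (f j) j] then forces
   [A i (f j) = 0]. *)
- rewrite -[k](permKV (perm f_inj)); set j := (perm f_inj)^-1%g k.
  rewrite (inj_eq perm_inj) permE eq_sym => /(tropinv_offdiag (f j))/eqP.
  by rewrite mulf_eq0 (negPf (Bfi j)) orbF => /eqP.
(* Here the nonzero [A j (f j)] forces [B (f j) i = 0]. *)
- rewrite -[k](permKV (perm f_inj)); set j := (perm f_inj)^-1%g k.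
  rewrite (inj_eq perm_inj) permE => /(tropinv_offdiag (f j))/eqP.
  by rewrite mulf_eq0 (negPf (Afi j)) => /eqP.
Qed.

End RightInverse.

Theorem theorem2p17 (R : realType) (n : nat) (hn : (1 <= n)%N)
    (A : 'M[R]_n) (hA : A \is a mxOver Num.nneg)
    (B : 'M[R]_n) (hB : B \is a mxOver Num.nneg)
    (hAB : A ⊙ B = 1%:M) :
  (exists (sigma : 'S_n) (D : 'M[R]_n),
     [/\ D \is a mxOver Num.nneg,
         is_diag_mx D,
         forall i : 'I_n, D i i != 0 &
         forall j : 'I_n, col j A = col ((sigma^-1)%g j) D]) /\
  (forall i j : 'I_n, B i j = if A j i == 0 then 0 else 1 / A j i).
Proof.
have [s [AB1 A0 B0]] := tropinv_perm hA hB hAB.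
have As_neq0 i : A i (s i) != 0.
  by apply/eqP => Ai0; have /eqP := AB1 i; rewrite Ai0 mul0r eq_sym oner_eq0.
split.
  (* The only nonzero entry of row [i] of [A] lies in column [s i]; moving it to the diagonal gives
     [D]. *)
  exists s, (diag_mx (\row_i A i (s i))); split=> [||i|j].
  - apply/mxOverP => i j; rewrite !mxE.
    by case: (i == j); rewrite ?mulr1n ?mulr0n ?rpred0 ?(mxOverP hA).
  - exact: diag_mx_is_diag.
  - by rewrite !mxE eqxx mulr1n.
  - apply/colP => i; rewrite !mxE; have [->|neq_i] := eqVneq i.
      by rewrite permKV mulr1n.
    by rewrite mulr0n A0 // -[j](permKV s) (inj_eq perm_inj) eq_sym.
(* Off [i = s j] both [A j i] and [B i j] vanish; on it, their product is 1. *)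
move=> i j; have [->|neq_i] := eqVneq i (s j); last by rewrite A0 ?eqxx ?B0.
by rewrite (negPf (As_neq0 j)) -(AB1 j) mulrC mulKf.
Qed.
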